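(* Consider $\mathcal{C}ob_{/l}$ over the ground ring $\mathbb{Z}$. Let $n,m\ge 0$ with $n+m\ge 1$, and choose one of the $n+m$ boundary circles as the special boundary circle. Let $H$ be the special 1-handle operator on $\mathrm{Mor}(\bigcirc^n,\bigcirc^m)$; this makes $\mathrm{Mor}(\bigcirc^n,\bigcirc^m)$ a module over the polynomial ring $\mathbb{Z}[H]$. Then $\mathrm{Mor}(\bigcirc^n,\bigcirc^m)$ is generated freely over $\mathbb{Z}[H]$ by the cobordisms composed of a genus-zero special component with any number of boundary circles on it (including the special circle) together with genus-zero non-special components having exactly one boundary circle each.
   Context: The category $\mathcal{C}ob_{/l}$ over a commutative ground ring $R$ (here $R=\mathbb{Z}$): objects are finite (possibly empty) disjoint unions of circles $\bigcirc^n$, $n\ge 0$ ($\bigcirc^0=\emptyset$). Morphisms from $\bigcirc^n$ to $\bigcirc^m$ are formal $R$-linear combinations of compact orientable 2-dimensional cobordisms from $\bigcirc^n$ to $\bigcirc^m$ (abstract surfaces, not necessarily connected, possibly with closed components; circles and cobordisms are oriented compatibly with gluing and cobordisms are taken up to homeomorphism fixing the boundary, so a cobordism is determined by the partition of its boundary circles into connected components, the genus of each component, and the genera of its closed components), modulo the following local relations. Composition is gluing, extended bilinearly. - 4TU: if $D_1,D_2,D_3,D_4$ are four disjoint disks in the interior of a (not necessarily connected) cobordism $C$ and $C_{ij}$ denotes the cobordism obtained from $C$ by removing $D_i$ and $D_j$ and gluing in a tube (annulus, compatible with orientations) with the same boundary, then $C_{12}+C_{34}=C_{13}+C_{24}$.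 - S: a cobordism with a connected component that is a sphere equals $0$. - T: a connected component that is a torus may be removed and replaced by the factor $2$. Given a chosen special boundary circle, the special component of a cobordism is the connected component containing that circle; all other components are non-special. The special 1-handle operator $H$ adds one handle to the special component (increases its genus by $1$), extended linearly. *)

(* Defs.v *)
From HB Require Import structures.
From mathcomp Require Import all_boot all_order all_algebra.
From mathcomp Require Import generic_quotient ring_quotient.
From mathcomp Require Import finmap multiset freeg.
From mathcomp Require Import boolp.

Set Implicit Arguments.
Unset Strict Implicit.
Unset Printing Implicit Defensive.

Import GRing.Theory.
Local Open Scope ring_scope.
Local Open Scope mset_scope.

Inductive gen_subgroup (V : zmodType) (G : V -> Prop) : V -> Prop :=
  | gen_subgroup_gen x : G x -> gen_subgroup G x
  | gen_subgroup_0 : gen_subgroup G 0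
  | gen_subgroup_sub x y :
      gen_subgroup G x -> gen_subgroup G y -> gen_subgroup G (x - y).

(* V as a Z[X]-module, X acting as the endomorphism phi. *)
Definition polymod (V : zmodType) (phi : {additive V -> V}) : Type := V.

HB.instance Definition _ (V : zmodType) (phi : {additive V -> V}) :=
  GRing.Zmodule.on (polymod phi).

Section PolyModule.
Variables (V : zmodType) (phi : {additive V -> V}).
Implicit Types (p q : {poly int}) (u v : V) (c : int).

Definition poly_act (p : {poly int}) (v : V) : V :=
  \sum_(i < size p) iter i phi v *~ p`_i.

Lemma poly_act_widen N p v : (size p <= N)%N ->
  poly_act p v = \sum_(i < N) iter i phi v *~ p`_i.
Proof.
move=> leN; rewrite /poly_act (big_ord_widen N (fun i => iter i phi v *~ p`_i)) //.
rewrite big_mkcond; apply: eq_bigr => i _.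
by case: ltnP => // /(nth_default 0) ->; rewrite mulr0z.
Qed.

Lemma iter_additive i : zmod_morphism (iter i phi).
Proof. by elim: i => [|i IH] u v //=; rewrite IH raddfB. Qed.

HB.instance Definition _ i :=
  GRing.isZmodMorphism.Build V V (iter i phi) (iter_additive i).

Lemma poly_actDl v : {morph poly_act^~ v : p q / p + q}.
Proof.
move=> p q; have := size_polyD p q; set N := maxn _ _ => leN.
rewrite (poly_act_widen v leN) (poly_act_widen v (leq_maxl _ _ : size p <= N)%N).
rewrite (poly_act_widen v (leq_maxr _ _ : size q <= N)%N) -big_split.
by apply: eq_bigr => i _; rewrite coefD mulrzDr.
Qed.

Lemma poly_actDr : right_distributive poly_act +%R.
Proof.
move=> p u v; rewrite /poly_act -big_split; apply: eq_bigr => i _.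
by rewrite raddfD mulrzDl.
Qed.

Lemma poly_act0 v : poly_act 0 v = 0.
Proof. by rewrite /poly_act size_poly0 big_ord0. Qed.

Lemma poly_act_r0 p : poly_act p 0 = 0.
Proof. by rewrite /poly_act big1 // => i _; rewrite raddf0 mul0rz. Qed.

Lemma poly_actC c v : poly_act c%:P v = v *~ c.
Proof.
rewrite (@poly_act_widen 1) ?size_polyC ?leq_b1 //.
by rewrite big_ord1 coefC.
Qed.

Lemma poly_actXr p v : poly_act p (phi v) = phi (poly_act p v).
Proof.
rewrite /poly_act raddf_sum; apply: eq_bigr => i _.
by rewrite raddfMz -iterSr.
Qed.

Lemma poly_actMX p v : poly_act (p * 'X) v = phi (poly_act p v).
Proof.
rewrite (@poly_act_widen (size p).+1); last first.
  by have [->|p0] := eqVneq p 0; rewrite ?mul0r ?size_poly0 ?size_mulX.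
rewrite big_ord_recl coefMX /= mulr0z add0r /poly_act raddf_sum.
by apply: eq_bigr => i _; rewrite coefMX raddfMz.
Qed.

Lemma poly_actZ p c v : poly_act (p * c%:P) v = poly_act p v *~ c.
Proof.
rewrite (@poly_act_widen (size p)); last first.
  by rewrite mulrC mul_polyC size_scale_leq.
rewrite /poly_act mulrz_suml; apply: eq_bigr => i _.
by rewrite coefMC mulrzA.
Qed.

Lemma poly_actMz p c v : poly_act p (v *~ c) = poly_act p v *~ c.
Proof.
rewrite /poly_act mulrz_suml; apply: eq_bigr => i _.
by rewrite raddfMz -!mulrzA mulrC.
Qed.

Lemma poly_actA p q v : poly_act p (poly_act q v) = poly_act (p * q) v.
Proof.
elim/poly_ind: q => [|q c IH]; first by rewrite mulr0 poly_act0 poly_act_r0.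
rewrite poly_actDl poly_actDr mulrDr poly_actDl poly_actMX poly_actXr IH.
by rewrite mulrA poly_actMX poly_actC poly_actMz poly_actZ.
Qed.

Lemma poly_actX v : poly_act 'X v = phi v.
Proof. by rewrite -['X]mul1r poly_actMX poly_actC. Qed.

Lemma poly_act1 : left_id 1 poly_act.
Proof. by move=> v; rewrite poly_actC. Qed.

HB.instance Definition _ :=
  GRing.Zmodule_isLmodule.Build {poly int} (polymod phi)
    poly_actA poly_act1 poly_actDr poly_actDl.

End PolyModule.

(* The family (e t)_{t in B} is a basis of M.  It is the family that is free,
   not just its set of values: e is in particular injective on B. *)
Definition free_basis (R : nzRingType) (M : lmodType R) (T : eqType)
    (B : {pred T}) (e : T -> M) : Prop :=
  (forall v : M, exists (r : seq T) (c : T -> R),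
      {subset r <= B} /\ v = \sum_(t <- r) c t *: e t) /\
  (forall (r : seq T) (c : T -> R), uniq r -> {subset r <= B} ->
      \sum_(t <- r) c t *: e t = 0 -> {in r, forall t, c t = 0}).

Section Cob.
Variables n m : nat.

Definition boundary : finType := ('I_n + 'I_m)%type.

(* (A, g): the connected surface of genus g with boundary circles A; it is
   closed when A is empty. *)
Definition component : choiceType := ({set boundary} * nat)%type.

Definition is_cobordism (w : seq component) : bool :=
  [forall b : boundary, count (fun x : component => b \in x.1) w == 1%N].

(* A cobordism up to homeomorphism fixing the boundary: a multiset, since closed
   components of equal genus may repeat. *)
Record cobordism := Cobordism {
  components : {mset component};
  componentsP : is_cobordism components }.
HB.instance Definition _ := [isSub for components].
HB.instance Definition _ := [Choice of cobordism by <:].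

Lemma is_cobordism_mset w : is_cobordism (seq_mset w) = is_cobordism w.
Proof.
by apply: eq_forallb => b; rewrite (seq.permP (perm_eq_seq_mset w)).
Qed.

Definition cob_of w (h : is_cobordism w) : cobordism :=
  @Cobordism (seq_mset w) (etrans (is_cobordism_mset w) h).

Definition add_closed_seq (g : nat) (C : cobordism) : seq component :=
  (set0, g) :: components C.

Lemma add_closedP g C : is_cobordism (add_closed_seq g C).
Proof.
by apply/forallP => b; rewrite /= inE add0n; apply: (forallP (componentsP C)).
Qed.

Definition add_closed g C := cob_of (add_closedP g C).

Definition add_handle_seq (s : boundary) (w : seq component) : seq component :=
  [seq (x.1, x.2 + (s \in x.1))%N | x : component <- w].

Lemma add_handleP s C : is_cobordism (add_handle_seq s (components C)).
Proof.
apply/forallP => b; rewrite count_map.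
exact: (forallP (componentsP C)).
Qed.

Definition add_handle s C := cob_of (add_handleP s C).

(* Components are designated by position, as the multiset may contain several
   closed components of the same genus. *)
Definition position (C : cobordism) : Type := 'I_(size (components C)).

Definition comp_at (C : cobordism) (i : position C) : component :=
  tnth (in_tuple (components C)) i.

(* Removing one disk from the component at i and one from the component at j
   and gluing in a tube: a new handle if i = j, a connected sum otherwise. *)
Definition tube_seq (C : cobordism) (i j : position C) : seq component :=
  let x := comp_at i in let y := comp_at j in
  (x.1 :|: y.1, if i == j then x.2.+1 else (x.2 + y.2)%N)
    :: [seq comp_at k | k : 'I_(size (components C)) in [predC pred2 i j]].

Lemma count_comp_at C b :
  count (fun x : component => b \in x.1) (components C) =
  (\sum_(k : position C) (b \in (comp_at k).1))%N.
Proof.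
rewrite -sum1_count big_mkcond (big_tnth _ _ (components C)).
by apply: eq_bigr => k _; rewrite /comp_at; case: (b \in _).
Qed.

Lemma sum_comp_at C b : (\sum_(k : position C) (b \in (comp_at k).1))%N = 1%N.
Proof. by rewrite -count_comp_at; apply/eqP/(forallP (componentsP C)). Qed.

Lemma comp_at_disjoint C (i j : position C) b : i != j ->
  b \in (comp_at i).1 -> b \in (comp_at j).1 = false.
Proof.
move=> ij bi; have := sum_comp_at C b.
rewrite (bigD1 i) //= (bigD1 j) /= 1?eq_sym // bi.
by case: (_ \in _).
Qed.

Lemma tubeP C i j : is_cobordism (@tube_seq C i j).
Proof.
apply/forallP => b; rewrite -(sum_comp_at C b) /= count_map inE.
rewrite -sum1_count big_enum_cond /=.
have -> : (\sum_(k | (k \in [predC pred2 i j]) && (b \in (comp_at k).1)) 1 =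
           \sum_(k | (k != i) && (k != j)) (b \in (comp_at k).1))%N.
  rewrite [LHS]big_mkcond [RHS]big_mkcond; apply: eq_bigr => k _.
  by rewrite !inE negb_or; case: (k != i); case: (k != j); case: (b \in _).
apply/eqP; rewrite [in RHS](bigD1 i) //=.
have [<-|ij] := eqVneq i j.
  by rewrite orbb; congr (_ + _)%N; apply: eq_bigl => k; case: (k != i).
rewrite [in RHS](bigD1 j) /= 1?eq_sym // addnA; congr (_ + _)%N.
have := @comp_at_disjoint C i j b ij.
by case: (b \in (comp_at i).1) => [->|] //; case: (b \in _).
Qed.

Definition tube C i j := cob_of (@tubeP C i j).

(* Only the components carrying the four disks matter in 4TU, and any four
   components, repetitions allowed, can occur. *)
Inductive local_relation : {freeg cobordism} -> Prop :=
  | rel_4TU C (i1 i2 i3 i4 : position C) :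
      local_relation (<<tube i1 i2>> + <<tube i3 i4>>
                      - (<<tube i1 i3>> + <<tube i2 i4>>))
  | rel_S C : local_relation <<add_closed 0 C>>
  | rel_T C : local_relation (<<add_closed 1 C>> - <<C>> *+ 2).

Definition null_cob : {pred {freeg cobordism}} :=
  fun x => `[< gen_subgroup local_relation x >].

Lemma null_cob_zmod_closed : zmod_closed null_cob.
Proof.
split=> [|x y /asboolP hx /asboolP hy]; apply/asboolP.
  exact: gen_subgroup_0.
exact: gen_subgroup_sub.
Qed.
HB.instance Definition _ :=
  GRing.isZmodClosed.Build {freeg cobordism} null_cob null_cob_zmod_closed.

Definition Mor := Quotient.quot null_cob.
HB.instance Definition _ := GRing.Zmodule.on Mor.

Definition mor (x : {freeg cobordism}) : Mor := \pi_Mor%qT x.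
Definition mor_of (C : cobordism) : Mor := mor <<C>>.

Lemma add_handle_closed s g C :
  add_handle s (add_closed g C) = add_closed g (add_handle s C).
Proof.
apply/val_inj/eq_seq_msetP.
rewrite (perm_trans (perm_map _ (perm_eq_seq_mset _))) //= inE addn0.
by rewrite perm_cons perm_sym perm_eq_seq_mset.
Qed.

Lemma add_handle_position s C :
  exists2 f : position C -> position (add_handle s C), bijective f &
    forall k, comp_at (f k) = ((comp_at k).1, ((comp_at k).2 + (s \in (comp_at k).1))%N).
Proof.
set w := components C; set w' := components (add_handle s C).
pose x0 : component := (set0, 0%N).
have pw : perm_eq (add_handle_seq s w) w' by rewrite perm_sym perm_eq_seq_mset.
have /(perm_iotaP x0) [r pr Er] := pw.
have szr : size r = size w by rewrite -(size_map (nth x0 w')) -Er size_map.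
have szw : size w' = size w by rewrite -(perm_size pw) size_map.
have ltr (k : position C) : (nth 0 r k < size w')%N.
  have : nth 0%N r k \in iota 0 (size w').
    by rewrite -(perm_mem pr) mem_nth // szr.
  by rewrite mem_iota.
pose f k : position (add_handle s C) := Ordinal (ltr k).
have fI : injective f.
  move=> k l /(congr1 val) /= /eqP; rewrite nth_uniq ?szr //.
    by move/eqP/val_inj.
  by rewrite (perm_uniq pr) iota_uniq.
exists f; first by apply: inj_card_bij => //; rewrite !card_ord szw.
move=> k; rewrite /comp_at (tnth_nth x0) /= -(nth_map _ x0) ?szr // -Er.
by rewrite (nth_map x0) // (tnth_nth x0).
Qed.

Lemma add_handle_tube s C : exists f : position C -> position (add_handle s C),
  forall i j, add_handle s (tube i j) = tube (f i) (f j).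
Proof.
have [f f_bij fE] := add_handle_position s C; exists f => i j.
have f_inj := bij_inj f_bij.
apply/val_inj/eq_seq_msetP.
rewrite (perm_trans (perm_map _ (perm_eq_seq_mset _))) //=.
rewrite /tube_seq !fE (inj_eq f_inj) /= inE.
have -> : ((if i == j then (comp_at i).2.+1 else ((comp_at i).2 + (comp_at j).2)) +
    ((s \in (comp_at i).1) || (s \in (comp_at j).1)) =
    if i == j then ((comp_at i).2 + (s \in (comp_at i).1)).+1
    else (comp_at i).2 + (s \in (comp_at i).1) +
         ((comp_at j).2 + (s \in (comp_at j).1)))%N.
  have [<-|ij] := eqVneq i j; first by rewrite orbb addSn.
  rewrite addnACA; congr (_ + _)%N.
  have := @comp_at_disjoint C i j s ij.
  by case: (s \in (comp_at i).1) => [->|] //; case: (s \in _).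
rewrite perm_cons -map_comp /image_mem.
rewrite (eq_map (g := @comp_at _ \o f)); last by move=> k /=; rewrite fE.
rewrite map_comp; apply/perm_map/uniq_perm.
- by rewrite map_inj_uniq ?enum_uniq.
- exact: enum_uniq.
move=> l; have [g fK gK] := f_bij; rewrite -[l]gK mem_map // !mem_enum !inE.
by rewrite !(inj_eq f_inj).
Qed.

Definition freeH (s : boundary) : {freeg cobordism} -> {freeg cobordism} :=
  fglift (fun C => <<add_handle s C>>).
Lemma freeH_additive s : zmod_morphism (freeH s).
Proof. exact: lift_is_additive. Qed.
HB.instance Definition _ s :=
  GRing.isZmodMorphism.Build _ _ (freeH s) (freeH_additive s).

Lemma freeHU s C : freeH s <<C>> = <<add_handle s C>>.
Proof. by rewrite /freeH liftU scale1r. Qed.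

Lemma freeH_null s x : x \in null_cob -> freeH s x \in null_cob.
Proof.
move=> /asboolP hx; apply/asboolP.
elim: hx => [_ [C i1 i2 i3 i4|C|C]||y z _ IHy _ IHz].
- have [f fE] := add_handle_tube s C.
  apply: gen_subgroup_gen; rewrite raddfB !(raddfD (freeH s)) /= !freeHU !fE.
  exact: rel_4TU.
- by apply: gen_subgroup_gen; rewrite freeHU add_handle_closed; apply: rel_S.
- apply: gen_subgroup_gen; rewrite raddfB raddfMn /= !freeHU add_handle_closed.
  exact: rel_T.
- by rewrite raddf0; apply: gen_subgroup_0.
- by rewrite raddfB; apply: gen_subgroup_sub.
Qed.

Definition special_handle (s : boundary) (v : Mor) : Mor := mor (freeH s (repr v)).

Lemma mor_eq x y : (mor x == mor y) = (x - y \in null_cob).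
Proof. by rewrite Quotient.idealrBE. Qed.

Lemma special_handle_mor s x : special_handle s (mor x) = mor (freeH s x).
Proof.
apply/eqP; rewrite mor_eq -raddfB; apply: freeH_null.
by rewrite -mor_eq; apply/eqP; apply: reprK.
Qed.

Lemma special_handle_mor_of s C : special_handle s (mor_of C) = mor_of (add_handle s C).
Proof. by rewrite /mor_of special_handle_mor freeHU. Qed.

Lemma special_handle_additive s : zmod_morphism (special_handle s).
Proof.
move=> u v; rewrite -[u]reprK -[v]reprK.
have morB x y : mor (x - y) = mor x - mor y by exact: raddfB.
by rewrite -!/(mor _) -morB !special_handle_mor raddfB morB.
Qed.
HB.instance Definition _ s :=
  GRing.isZmodMorphism.Build Mor Mor (special_handle s) (special_handle_additive s).

Definition standard (s : boundary) : pred cobordism := fun C =>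
  all (fun x : component =>
         if s \in x.1 then x.2 == 0%N else (x.2 == 0%N) && (#|x.1| == 1%N))
      (components C).

End Cob.

(* Main.v *)
From HB Require Import structures.
Require Import Defs.
From mathcomp Require Import all_boot all_order all_algebra.
From mathcomp Require Import fraction.
From mathcomp Require Import multiset freeg boolp.
From mathcomp Require Import ring.

(** Generation: 4TU with one disk on a component x, one on y and two on the
special component p gives x # y = x # p + y # p - H, where x = y is allowed and
x # y then means adding a handle to x. So non-special components can be split
into disks, apart from spheres, which vanish.

Freeness: solving the same relation by e(A, g) = (h^g - (-h)^g \prod_(b in A) z_b) / h,
with z_s = 0, makes h \prod e(component) a functional on Mor on which H acts as h.
For h = 'X in the fraction field of Z['X], z_b = 1 - h for b in U and z_b = 1
otherwise, its value on the generator with special component A is 1 if the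
complement of A lies in U and 0 otherwise; these values are triangular for
inclusion. *)

Set Implicit Arguments.
Unset Strict Implicit.
Unset Printing Implicit Defensive.

Import GRing.Theory.
Local Open Scope ring_scope.

Section Cobordisms.
Variables n m : nat.
Implicit Types (C : cobordism n m) (x y : component n m) (w : seq (component n m)).
Implicit Types (s b : boundary n m) (A B U : {set boundary n m}).

(** * Components, positions and tubes up to permutation *)

Lemma perm_cob_of w (h : is_cobordism w) : perm_eq (components (cob_of h)) w.
Proof. exact: perm_eq_seq_mset. Qed.

Lemma cobordism_eq C1 C2 :
  perm_eq (components C1) (components C2) -> C1 = C2.
Proof. by move=> /eq_seq_msetP; rewrite !seq_mset_id => /val_inj. Qed.

Lemma count_component C b :
  count (fun x : component n m => b \in x.1) (components C) = 1%N.
Proof. exact/eqP/(forallP (componentsP C)). Qed.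

Lemma component_disjoint C w x y b : perm_eq (components C) (x :: w) ->
  y \in w -> b \in x.1 -> b \in y.1 -> False.
Proof.
move=> /permP e yw bx by_; have := count_component C b; rewrite e /= bx.
case=> /eqP; rewrite -leqn0 leqNgt -has_count => /hasP[].
by exists y.
Qed.

Lemma position_of C x : x \in components C -> exists i : position C, x = comp_at i.
Proof. by move=> xC; apply/tnthP. Qed.

Lemma special_position C s : exists p : position C, s \in (comp_at p).1.
Proof.
have : has (fun x : component n m => s \in x.1) (components C).
  by rewrite has_count count_component.
by case/hasP => x /position_of[p ->]; exists p.
Qed.

Lemma big_comp_at (R : Type) (idx : R) (op : Monoid.com_law idx) C
    (F : component n m -> R) :
  \big[op/idx]_(x <- components C) F x = \big[op/idx]_(k : position C) F (comp_at k).
Proof. exact: (big_tnth _ _ (components C)). Qed.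

Definition glue C (i j : position C) : component n m :=
  ((comp_at i).1 :|: (comp_at j).1,
   if i == j then (comp_at i).2.+1 else ((comp_at i).2 + (comp_at j).2)%N).

Definition other_components C (i j : position C) : seq (component n m) :=
  [seq comp_at k | k : position C in [predC pred2 i j]].

Lemma perm_tube C (i j : position C) :
  perm_eq (components (tube i j)) (glue i j :: other_components i j).
Proof. exact: perm_eq_seq_mset. Qed.

Lemma perm_position C (i j : position C) :
  perm_eq (components C)
    ((if i == j then [:: comp_at i] else [:: comp_at i; comp_at j])
       ++ other_components i j).
Proof.
have e : [seq comp_at k | k : position C] = components C :> seq _.
  exact: (map_tnth_enum (in_tuple (components C))).
rewrite -[X in perm_eq X _]e.
have [<-|ij] := eqVneq i j.
  rewrite /other_components /image_mem cat1s -map_cons; apply/perm_map/uniq_perm.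
  - exact: enum_uniq.
  - by rewrite cons_uniq enum_uniq mem_enum !inE eqxx.
  by move=> k; rewrite !inE !mem_enum !inE orbb; case: eqP.
rewrite /other_components /image_mem /= -!map_cons; apply/perm_map/uniq_perm.
- exact: enum_uniq.
- by rewrite /= !inE !mem_enum !inE negb_or ij enum_uniq !eqxx orbT.
by move=> k; rewrite !inE !mem_enum !inE; case: eqP => // _; case: eqP.
Qed.

Lemma big_tube (R : Type) (idx : R) (op : Monoid.com_law idx) C (i j : position C)
    (F : component n m -> R) :
  \big[op/idx]_(x <- components (tube i j)) F x =
  op (F (glue i j)) (\big[op/idx]_(k | (k != i) && (k != j)) F (comp_at k)).
Proof.
rewrite (perm_big _ (perm_tube i j)) big_cons big_map big_enum_cond.
congr (op _ _); apply: eq_bigl => k.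
by rewrite !inE andbT negb_or.
Qed.

Lemma perm_add_closed g C :
  perm_eq (components (add_closed g C)) ((set0, g) :: components C).
Proof. exact: perm_eq_seq_mset. Qed.

(** Since [s] lies on no other component, [add_handle] changes only the one at [p]. This identifies
    the 4TU term with both disks on the special component as a value of [H]. *)
Lemma tube_special C s (p : position C) : s \in (comp_at p).1 ->
  tube p p = add_handle s C.
Proof.
move=> sp; apply/cobordism_eq.
rewrite (perm_trans (perm_tube _ _)) // perm_sym.
rewrite (perm_trans (perm_eq_seq_mset _)) //.
have := perm_position p p; rewrite eqxx => e.
rewrite (perm_trans (perm_map _ e)) //= sp addn1 /glue eqxx setUid perm_cons.
rewrite map_id_in // => x xo.
case sx: (s \in x.1); last by rewrite addn0; case: x {xo sx}.
by case: (component_disjoint e xo sp).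
Qed.

(** * The local relations read in [Mor] *)

Lemma mor_is_zmod_morphism : zmod_morphism (@mor n m).
Proof. by move=> u v; exact: raddfB. Qed.

HB.instance Definition _ :=
  GRing.isZmodMorphism.Build _ _ (@mor n m) mor_is_zmod_morphism.

Lemma mor_relation u : local_relation u -> mor u = 0 :> Mor n m.
Proof.
move=> hu; rewrite -(raddf0 (@mor n m)); apply/eqP.
by rewrite mor_eq subr0; apply/asboolP/gen_subgroup_gen.
Qed.

Lemma mor_of_sphere C : mor_of (add_closed 0 C) = 0.
Proof. exact/mor_relation/rel_S. Qed.

(** 4TU with disks on [i], [j], [p], [p], where [tube p p] is the special handle. *)
Lemma mor_of_tube C s (i j p : position C) : s \in (comp_at p).1 ->
  mor_of (tube i j) =
    mor_of (tube i p) + mor_of (tube j p) - special_handle s (mor_of C).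
Proof.
move=> sp; have := mor_relation (rel_4TU i j p p).
rewrite raddfB !(raddfD (@mor n m)) => /eqP; rewrite subr_eq0 => /eqP e.
by rewrite special_handle_mor_of -(tube_special sp) -e addrK.
Qed.

(** * Standard cobordisms indexed by the boundary of the special component *)

Lemma std_is_cobordism A :
  is_cobordism ((A, 0%N) :: [seq ([set b], 0%N) | b in ~: A]).
Proof.
apply/forallP => b; rewrite /= count_map -sum1_count big_enum_cond /=.
rewrite (eq_bigl (fun b' => (b' == b) && (b \notin A))) => [|b']; last first.
  rewrite !inE [b == _]eq_sym andbC; case: eqP => [->|] //.
by rewrite big_mkcondr big_pred1_eq; case: (b \in A).
Qed.

Definition std A : cobordism n m := cob_of (std_is_cobordism A).

Lemma mem_std A x :
  (x \in components (std A)) = (x == (A, 0%N)) ||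
    (x \in [seq ([set b], 0%N) | b in ~: A]).
Proof. by rewrite (perm_mem (perm_cob_of _)) inE. Qed.

(** Membership of [s] matters here: [std [set b]] is the same union of disks for every [b]. If
    [(A, 0)] were one of the disks of [std B], its only circle would be [s], which lies in [B]. *)
Lemma std_inj s : {in [pred A : {set boundary n m} | s \in A] &, injective std}.
Proof.
move=> A B sA sB e; have := mem_std A (A, 0%N).
rewrite eqxx e mem_std => /orP[/eqP[]//|/imageP[b]].
rewrite !inE in sA sB * => bB [AE]; move: sA; rewrite AE inE => /eqP sb.
by rewrite -sb sB in bB.
Qed.

Lemma standard_std s A : s \in A -> standard s (std A).
Proof.
move=> sA; apply/allP => x; rewrite mem_std => /orP[/eqP->|/imageP[b bA ->]] /=.
  by rewrite sA.
by rewrite cards1; case: ifP.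
Qed.

Lemma standardP s C : standard s C ->
  exists2 A : {set boundary n m}, s \in A & C = std A.
Proof.
move=> /allP stC; have [p sp] := special_position C s.
set A := (comp_at p).1 in sp *; exists A => //.
have pC : comp_at p \in components C by exact: mem_tnth.
have pE : comp_at p = (A, 0%N).
  have := stC _ pC; rewrite sp => /eqP.
  by rewrite /A; case: (comp_at p) => ? ? /= ->.
have e := perm_position p p; rewrite eqxx pE cat1s in e.
apply/cobordism_eq; rewrite (perm_trans e) // perm_sym.
rewrite (perm_trans (perm_cob_of _)) // perm_cons perm_sym.
have stO x : x \in other_components p p ->
    exists2 b, b \notin A & x = ([set b], 0%N).
  move=> xo; have := stC x; rewrite (perm_mem e) inE xo orbT => /(_ isT).
  case: ifP => [sx|_ /andP[/eqP x2 /cards1P[b x1]]].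
    by case: (component_disjoint e xo sp sx).
  exists b; last by rewrite -x1 -x2; case: (x).
  by apply/negP => bA; apply: (component_disjoint e xo (b := b)); rewrite // x1 inE.
(* This bound rules out a repeated disk in the multiset: all copies of a disk on [b] would contain
   [b]. *)
have le1 b :
    (count (fun x : component n m => b \in x.1) (other_components p p) <= 1)%N.
  by rewrite -(count_component C b) (permP e) /= leq_addl.
apply: uniq_perm.
- apply: count_mem_uniq => x; apply/eqP; rewrite eqn_leq.
  have [xo|/count_memPn->] := boolP (x \in _); last by [].
  rewrite -has_count has_pred1 xo andbT; have [b _ xE] := stO x xo.
  apply: leq_trans (le1 b); apply: sub_count => y /= /eqP ->.
  by rewrite xE inE.
- rewrite map_inj_uniq ?enum_uniq // => b b' [/setP/(_ b)].
  by rewrite !inE eqxx => /esym/eqP.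
move=> x; apply/idP/imageP => [/stO[b bA ->]|[b]]; first by exists b; rewrite ?inE.
rewrite inE => bA ->; have := count_component C b.
rewrite (permP e) /= (negPf bA) add0n => c1.
have /hasP[y yo by_] :
    has (fun x : component n m => b \in x.1) (other_components p p).
  by rewrite has_count c1.
by have [b' _ yE] := stO y yo; move: by_; rewrite yE inE => /eqP ->; rewrite -yE.
Qed.

(** * Undoing tubes, and a complexity that this lowers *)

Lemma tube_handle C w A g : perm_eq (components C) ((A, g.+1) :: w) ->
  exists (C' : cobordism n m) (i : position C'),
    [/\ perm_eq (components C') ((A, g) :: w), comp_at i = (A, g) & C = tube i i].
Proof.
move=> eC; have h : is_cobordism ((A, g) :: w).
  by apply/forallP => b; rewrite -(count_component C b) (permP eC).
have e := perm_cob_of h; set C' := cob_of h in e.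
have /position_of[i iE] : (A, g) \in components C' by rewrite (perm_mem e) mem_head.
exists C', i; split=> //; apply/cobordism_eq; rewrite (perm_trans eC) // perm_sym.
rewrite (perm_trans (perm_tube i i)) // /glue eqxx -iE setUid perm_cons.
have := perm_position i i; rewrite eqxx cat1s -iE perm_sym => ei.
by have := perm_trans ei e; rewrite perm_cons.
Qed.

Lemma tube_split C w A B g :
  perm_eq (components C) ((A :|: B, g) :: w) -> [disjoint A & B] -> A != set0 ->
  exists (C' : cobordism n m) (i j : position C'),
    perm_eq (components C') [:: (A, 0%N), (B, g) & w] /\ C = tube i j.
Proof.
move=> eC dAB A0; have h : is_cobordism [:: (A, 0%N), (B, g) & w].
  apply/forallP => b; rewrite -(count_component C b) (permP eC) /= addnA inE.
  by have := disjointFr dAB (x := b); case: (b \in A) => [->|].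
have e := perm_cob_of h; set C' := cob_of h in e.
have /position_of[i iE] : (A, 0%N) \in components C'.
  by rewrite (perm_mem e) mem_head.
have /position_of[j jE] : (B, g) \in components C'.
  by rewrite (perm_mem e) !inE eqxx orbT.
(* The positions come from membership alone and could coincide for equal components; but then
   [A = B] would be disjoint from itself, hence empty. *)
have ij : i != j.
  apply: contraNneq A0 => ij; move: jE; rewrite -ij -iE => -[BA _].
  by rewrite -setI_eq0 BA setIid in dAB.
exists C', i, j; split=> //; apply/cobordism_eq.
rewrite (perm_trans eC) // perm_sym (perm_trans (perm_tube i j)) //.
rewrite /glue (negPf ij) -iE -jE add0n perm_cons.
have := perm_position i j; rewrite (negPf ij) -iE -jE perm_sym => ei.
by have := perm_trans ei e; rewrite !perm_cons.
Qed.

(* Zero exactly on special components, spheres and disks. *)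
Definition weight s x : nat := if s \in x.1 then 0%N else (#|x.1|.-1 + x.2)%N.

Definition complexity s C : nat := (\sum_(x <- components C) weight s x)%N.

(** The component at [i] is absorbed into the special one, whose weight is 0, and the remaining
    weights are unchanged. *)
Lemma complexity_tube s C (i p : position C) : s \in (comp_at p).1 ->
  (complexity s (tube i p) <= complexity s C)%N.
Proof.
move=> sp; rewrite /complexity big_tube /= /weight /glue /= inE sp orbT add0n.
by rewrite big_comp_at /= [leqRHS](bigID (fun k => (k != i) && (k != p))) leq_addr.
Qed.

(** * Generation by the standard cobordisms *)

Definition in_span s (v : polymod (special_handle s)) : Prop :=
  exists c : {set boundary n m} -> {poly int},
    v = \sum_(A : {set boundary n m} | s \in A)
          c A *: (mor_of (std A) : polymod (special_handle s)).

Lemma in_span0 s : in_span (0 : polymod (special_handle s)).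
Proof. by exists (fun=> 0); rewrite big1 // => A _; rewrite scale0r. Qed.

Lemma in_spanB s (u v : polymod (special_handle s)) :
  in_span u -> in_span v -> in_span (u - v).
Proof.
move=> [c ->] [d ->]; exists (fun A => c A - d A).
by rewrite -sumrB; apply: eq_bigr => A _; rewrite scalerBl.
Qed.

Lemma in_spanD s (u v : polymod (special_handle s)) :
  in_span u -> in_span v -> in_span (u + v).
Proof.
move=> hu hv; rewrite -[v]opprK -[- v]sub0r.
by do !apply: in_spanB => //; apply: in_span0.
Qed.

Lemma in_spanZ s p (v : polymod (special_handle s)) : in_span v -> in_span (p *: v).
Proof.
move=> [c ->]; exists (fun A => p * c A); rewrite scaler_sumr.
by apply: eq_bigr => A _; rewrite scalerA.
Qed.

Lemma in_span_handle s (v : polymod (special_handle s)) :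
  in_span v -> in_span (special_handle s v : polymod (special_handle s)).
Proof. by move=> /(in_spanZ 'X); rewrite /GRing.scale /= poly_actX. Qed.

Lemma in_span_std s A : s \in A ->
  in_span (mor_of (std A) : polymod (special_handle s)).
Proof.
move=> sA; exists (fun B => (B == A)%:R); rewrite (bigD1 A) //= eqxx scale1r.
by rewrite big1 ?addr0 // => B /andP[_ /negPf->]; rewrite scale0r.
Qed.

(** Induction on the total genus, which is here the genus of the special component: a sphere makes
    the class 0, and each special handle is taken out as a factor [H]. *)
Lemma in_span_simple s C : complexity s C = 0%N ->
  in_span (mor_of C : polymod (special_handle s)).
Proof.
have [k] := ubnP (\sum_(x <- components C) x.2)%N.
elim: k C => // k IH C; rewrite ltnS => leC /eqP.
rewrite sum_nat_seq_eq0 => /allP w0.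
have [/perm_to_rem e|no_sphere] := boolP ((set0, 0%N) \in components C).
  have h : is_cobordism (rem (set0, 0%N) (components C)).
    apply/forallP => b; have := count_component C b.
    by rewrite (permP e) /= inE add0n => ->.
  rewrite (_ : C = add_closed 0 (cob_of h)) ?mor_of_sphere; first exact: in_span0.
  apply/cobordism_eq; rewrite (perm_trans e) // perm_sym.
  rewrite (perm_trans (perm_add_closed _ _)) // perm_cons.
  exact: perm_cob_of.
have [/standardP[A sA ->]|] := boolP (standard s C); first exact: in_span_std.
case/allPn => -[A g] xC; have := w0 _ xC; rewrite /weight /=.
(* A non-special component of weight 0 is a disk, which is standard, or a sphere, already excluded.
   So the offending component is special and has positive genus. *)
case: ifP => sA; last first.
  rewrite addn_eq0 => /andP[A1 /eqP g0]; rewrite g0 /= in xC *.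
  case E: #|A| A1 => [|[|//]] //; move/eqP: E; rewrite cards_eq0 => /eqP A0.
  by rewrite A0 (negPf no_sphere) in xC.
case: g xC => // g xC _ _; have e := perm_to_rem xC.
have [C' [i [e' iE ->]]] := tube_handle e.
rewrite (tube_special (s := s)) ?iE // -special_handle_mor_of.
apply/in_span_handle/IH.
  by move: leC; rewrite (perm_big _ e) (perm_big _ e') !big_cons /=.
apply/eqP; rewrite /complexity (perm_big _ e') big_cons /= /weight /= sA add0n.
rewrite sum_nat_seq_eq0; apply/allP => x xr.
by apply: w0; rewrite (perm_mem e) inE xr orbT.
Qed.

Lemma simplify_tube s C : (0 < complexity s C)%N ->
  exists (C' : cobordism n m) (i j : position C'),
    C = tube i j /\ (complexity s C' < complexity s C)%N.
Proof.
rewrite lt0n sum_nat_seq_neq0 => /hasP[[A g] xC /=].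
have e := perm_to_rem xC.
rewrite {2}/complexity (perm_big _ e) big_cons /= /weight /=.
case: ifP => // sA wA.
(* With at most one circle the weight is the genus, so a handle is undone; with more circles a disk
   bounded by one of them is split off. *)
have [A1|A2] := leqP #|A| 1.
  have A0 : #|A|.-1 = 0%N by case: #|A| A1 => [|[]].
  case: g xC e wA => [|g] xC e wA; first by rewrite A0 in wA.
  have [C' [i [e' _ CE]]] := tube_handle e; exists C', i, i; split=> //.
  by rewrite /complexity (perm_big _ e') big_cons /= /weight /= sA addnS.
have /card_gt0P[b bA] : (0 < #|A|)%N by apply: ltn_trans A2.
have e1 : perm_eq (components C)
    (([set b] :|: (A :\ b), g) :: rem (A, g) (components C)) by rewrite setD1K.
have dAb : [disjoint [set b] & A :\ b].
  by rewrite disjoints1 !inE eqxx.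
have b0 : [set b] != set0 by apply/set0Pn; exists b; rewrite inE.
have [C' [i [j [e' CE]]]] := tube_split e1 dAb b0; exists C', i, j; split=> //.
rewrite /complexity (perm_big _ e') !big_cons /= /weight /= !inE.
have -> : (s == b) = false by apply/negP => /eqP sb; rewrite sb bA in sA.
rewrite /= sA cards1 !add0n !ltn_add2r.
by rewrite (cardsD1 b A) bA in A2 *; case: #|_| A2.
Qed.

(** Strong induction on complexity. With [C] a tube on a simpler [C'], [mor_of_tube] leaves two
    tubes ending on the special component, no more complex than [C'], and [H] applied to [C']. *)
Lemma in_span_mor_of s C : in_span (mor_of C : polymod (special_handle s)).
Proof.
have [k] := ubnP (complexity s C); elim: k C => // k IH C.
rewrite ltnS => leC; have [C0|C0] := posnP (complexity s C).
  exact: in_span_simple.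
have [C' [i [j [CE lt]]]] := simplify_tube C0; have ltk := leq_trans lt leC.
have [p sp] := special_position C' s.
rewrite CE (mor_of_tube _ _ sp); apply: in_spanB.
  by apply: in_spanD; apply: IH; apply: leq_ltn_trans ltk; apply: complexity_tube.
exact/in_span_handle/IH.
Qed.

Lemma in_span_all s (v : polymod (special_handle s)) : in_span v.
Proof.
have -> : v = mor (repr v) by rewrite /mor reprK.
rewrite -[repr v]freeg_sumE raddf_sum.
elim/big_ind: _ => [|u1 u2|C _]; [exact: in_span0|exact: in_spanD|].
have -> : << coeff C (repr v) *g C >> = << C >> *~ coeff C (repr v).
  by rewrite freegU_mulz intz.
rewrite raddfMz -(poly_actC (special_handle s)); exact/in_spanZ/in_span_mor_of.
Qed.

(** * Functionals on [Mor] built from values of components *)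

Section Evaluation.
Variables (K : fieldType) (h : K) (z : boundary n m -> K).
Hypothesis h_neq0 : h != 0.

(* Writing e for [comp_value], J for [h ^+ g] and f for J - h e, the relation
   e(x # y) = J(x) e(y) + e(x) J(y) - h e(x) e(y) says that f is multiplicative,
   and for handles it says that a handle multiplies f by -h. *)
Definition comp_value x : K :=
  (h ^+ x.2 - (- h) ^+ x.2 * \prod_(b in x.1) z b) / h.

(** The factor [h] cancels the inverse of [h] contributed by a genus-zero special component when
    [z s = 0]. *)
Definition cob_value C : K := h * \prod_(x <- components C) comp_value x.

(** When [z s = 0], this is the value of the tube from [k] to the special component. *)
Definition join_value C (k : position C) : K :=
  h * h ^+ (comp_at k).2 * \prod_(l | l != k) comp_value (comp_at l).

(** The counterpart of [mor_of_tube]. The right side is a term in [i], the same term in [j] and a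
    constant, so both sides of 4TU get the same value. *)
Lemma cob_value_tube C (i j : position C) :
  cob_value (tube i j) = join_value i + join_value j - h * cob_value C.
Proof.
rewrite /join_value /cob_value big_tube big_comp_at /=.
rewrite [X in h * (h * X)](bigD1 i) //=.
have [->|ij] := eqVneq i j.
  under eq_bigl do rewrite andbb.
  set P := \prod_(_ | _) _; rewrite /glue eqxx setUid /comp_value /= !exprS.
  move: (h ^+ _) ((- h) ^+ _) (\prod_(b in _) _) P => u v w P.
  by field.
(* Disjoint boundaries let the product of [z] over the glued component factor. *)
have disj : [disjoint (comp_at i).1 & (comp_at j).1].
  by apply/pred0P => b /=; apply/negP => /andP[bi]; rewrite (comp_at_disjoint ij bi).
rewrite ![\prod_(l | l != i) _](bigD1 j) /= 1?eq_sym //.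
rewrite [\prod_(l | l != j) _](bigD1 i) //=.
under [\prod_(l | (l != j) && _) _]eq_bigl do rewrite andbC.
set P := \prod_(_ | _) _; rewrite /glue (negPf ij) /comp_value /= !exprD.
rewrite (eq_bigl [predU (comp_at i).1 & (comp_at j).1]) => [|b]; last first.
  by rewrite !inE.
rewrite bigU //=.
move: (h ^+ _) (h ^+ _) ((- h) ^+ _) ((- h) ^+ _) => u1 u2 v1 v2.
move: (\prod_(b in _) _) (\prod_(b in _) _) P => w1 w2 P.
by field.
Qed.

(** The factor is 0 for [g = 0] and 2 for [g = 1], as S and T require. *)
Lemma cob_value_closed g C :
  cob_value (add_closed g C) = (h ^+ g - (- h) ^+ g) / h * cob_value C.
Proof.
rewrite /cob_value (perm_big _ (perm_add_closed g C)) big_cons mulrCA.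
by rewrite {1}/comp_value /= big_set0 mulr1.
Qed.

(** As [z s = 0] kills the product over its boundary, a special component of genus [g] has value
    [h ^+ g / h]. *)
Lemma cob_value_handle s C : z s = 0 ->
  cob_value (add_handle s C) = h * cob_value C.
Proof.
move=> zs; have [p sp] := special_position C s.
have special_value g : comp_value ((comp_at p).1, g) = h ^+ g / h.
  by rewrite /comp_value /= (bigD1 s) //= zs mul0r mulr0 subr0.
rewrite -(tube_special sp) /cob_value big_tube big_comp_at /= [in RHS](bigD1 p) //=.
under eq_bigl do rewrite andbb.
rewrite /glue eqxx setUid special_value.
rewrite (surjective_pairing (comp_at p)) special_value.
by rewrite exprS -!mulrA.
Qed.

Definition free_value (u : {freeg cobordism n m}) : K :=
  fglift (cob_value : _ -> zmodule K) u.

Lemma free_value_is_zmod_morphism : zmod_morphism free_value.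
Proof. exact: (lift_is_additive (cob_value : _ -> zmodule K)). Qed.
HB.instance Definition _ :=
  GRing.isZmodMorphism.Build _ _ free_value free_value_is_zmod_morphism.

Lemma free_valueU C : free_value << C >> = cob_value C.
Proof. by rewrite /free_value liftU scale1r. Qed.

Lemma free_value_null u : u \in @null_cob n m -> free_value u = 0.
Proof.
move=> /asboolP; elim=> [_ [C i1 i2 i3 i4|C|C]||u1 u2 _ IH1 _ IH2].
- rewrite raddfB !(raddfD free_value) /= !free_valueU !cob_value_tube.
  move: (join_value i1) (join_value i2) (join_value i3) (join_value i4).
  by move: (h * _) => b a1 a2 a3 a4; ring.
- by rewrite free_valueU cob_value_closed !expr0 subrr mul0r mul0r.
- rewrite raddfB raddfMn /= !free_valueU cob_value_closed !expr1.
  by move: (cob_value C) => a; field.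
- exact: raddf0.
by rewrite raddfB /= IH1 IH2 subrr.
Qed.

Definition mor_value (v : Mor n m) : K := free_value (repr v).

Lemma mor_valueE u : mor_value (mor u) = free_value u.
Proof.
apply/eqP; rewrite -subr_eq0 -(raddfB free_value) /= free_value_null // -mor_eq.
by apply/eqP; apply: reprK.
Qed.

Lemma mor_value_is_zmod_morphism : zmod_morphism mor_value.
Proof.
move=> u v; rewrite -[u]reprK -[v]reprK -!/(mor _) -(raddfB (@mor n m)) !mor_valueE.
exact: raddfB.
Qed.
HB.instance Definition _ :=
  GRing.isZmodMorphism.Build _ _ mor_value mor_value_is_zmod_morphism.

Lemma mor_value0 : mor_value 0 = 0.
Proof. exact: raddf0. Qed.

Lemma mor_value_handle s v : z s = 0 ->
  mor_value (special_handle s v) = h * mor_value v.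
Proof.
move=> zs; rewrite -[v]reprK -/(mor _) special_handle_mor !mor_valueE.
move: (repr v) => u; rewrite -[u]freeg_sumE !raddf_sum mulr_sumr /=.
apply: eq_bigr => C _; rewrite -[coeff _ _]intz -freegU_mulz !raddfMz /=.
by rewrite freeHU !free_valueU cob_value_handle // mulrzAr.
Qed.

(** Semilinearity along [r], by Horner induction on [p]; constants are integers, which every ring
    morphism preserves. *)
Lemma mor_value_scale s (r : {rmorphism {poly int} -> K}) p
    (v : polymod (special_handle s)) :
  z s = 0 -> r 'X = h -> mor_value (p *: v) = r p * mor_value v.
Proof.
move=> zs rX; rewrite /GRing.scale /=.
elim/poly_ind: p => [|p c IH]; first by rewrite poly_act0 !raddf0 mul0r.
rewrite poly_actDl poly_actMX poly_actC rmorphD rmorphM mulrDl rX.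
rewrite (raddfD mor_value) raddfMz /= mor_value_handle // IH.
by rewrite mulrA [h * _]mulrC -[c in r c%:P]intz !rmorph_int mulrzl.
Qed.

Lemma mor_value_sum s (r : {rmorphism {poly int} -> K}) (t : seq (cobordism n m))
    (c : cobordism n m -> {poly int}) : z s = 0 -> r 'X = h ->
  mor_value (\sum_(C <- t) c C *: (mor_of C : polymod (special_handle s))) =
  \sum_(C <- t) r (c C) * mor_value (mor_of C).
Proof.
move=> zs rX; rewrite (raddf_sum mor_value).
by apply: eq_bigr => C _; apply: mor_value_scale.
Qed.

End Evaluation.

(** The disk on [b] has value [(1 - z b) / h], which is the indicator of [b \in U], so the product
    over the complement of [A] tests inclusion in [U]. *)
Lemma mor_value_std (K : fieldType) (h : K) s U A :
  h != 0 -> s \in A ->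
  mor_value h (fun b => if b == s then 0 else 1 - h * (b \in U)%:R) (mor_of (std A))
  = (~: A \subset U)%:R.
Proof.
move=> h0 sA; rewrite mor_valueE // free_valueU /cob_value.
rewrite (perm_big _ (perm_cob_of _)).
rewrite big_cons big_map big_enum /= /comp_value /= (bigD1 s) //= eqxx.
rewrite mul0r mulr0 subr0 !expr0 mul1r mulrA mulfV // mul1r.
under eq_bigr => b bA.
  rewrite big_set1 mul1r; have -> : (b == s) = false.
    by apply: contraTF bA => /eqP ->; rewrite inE sA.
  by rewrite opprB addrC addrNK mulrC mulKf //; over.
have [/subsetP AU|/subsetPn[b bA bU]] := boolP (~: A \subset U).
  by rewrite big1 // => b /AU ->.
by rewrite (bigD1 b) //= (negPf bU) mul0r.
Qed.

(** * The two halves of the basis property *)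

Lemma standard_generate s (v : polymod (special_handle s)) :
  exists (r : seq (cobordism n m)) (c : cobordism n m -> {poly int}),
    {subset r <= standard s} /\
    v = \sum_(C <- r) c C *: (mor_of C : polymod (special_handle s)).
Proof.
have [c ->] := in_span_all v.
(* A left inverse of [std] on sets containing [s], carrying coefficients from sets to cobordisms;
   the default is never reached on the list used. *)
pose sp C := odflt set0 [pick A : {set boundary n m} | (s \in A) && (C == std A)].
have spK A : s \in A -> sp (std A) = A.
  move=> sA; rewrite /sp; case: pickP => [B /andP[sB /eqP/esym]|/(_ A)].
    exact: (std_inj (s := s)).
  by rewrite sA eqxx.
exists [seq std A | A in [pred A : {set boundary n m} | s \in A]], (c \o sp); split.
  by move=> C /imageP[A sA ->]; apply: standard_std.
rewrite big_map big_enum_cond /=; apply: eq_big => [A|A sA].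
  by rewrite inE andbT.
by rewrite spK.
Qed.

Lemma standard_free s (r : seq (cobordism n m)) (c : cobordism n m -> {poly int}) :
  uniq r -> {subset r <= standard s} ->
  \sum_(C <- r) c C *: (mor_of C : polymod (special_handle s)) = 0 ->
  {in r, forall C, c C = 0}.
Proof.
move=> Ur rstd sum0; pose h : {fraction {poly int}} := tofrac 'X.
have h0 : h != 0 by rewrite tofrac_eq0 polyX_eq0.
have rel (U : {set boundary n m}) : \sum_(C <- r) tofrac (c C) *
    mor_value h (fun b => if b == s then 0 else 1 - h * (b \in U)%:R) (mor_of C) = 0.
  rewrite -(mor_value_sum (s := s)
    (r := @tofrac {poly int} : {rmorphism {poly int} -> {fraction {poly int}}}) h0)
    ?eqxx //.
  by rewrite sum0 mor_value0.
(* Induction on the size of the complement of [A]. Testing with [U = ~: A] keeps only the [std B]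
   with [~: B] inside [~: A]; when [B] differs from [A] the inclusion is proper and the coefficient
   is already 0. *)
suff cstd k A : (#|~: A| < k)%N -> s \in A -> std A \in r -> c (std A) = 0.
  move=> C Cr; have [A sA CE] := standardP (rstd _ Cr).
  by rewrite CE in Cr *; apply: cstd Cr.
elim: k A => // k IH A; rewrite ltnS => leA sA Ar; have := rel (~: A).
rewrite (bigD1_seq _ Ar Ur) /= mor_value_std // subxx mulr1 big1_seq ?addr0.
  by move/eqP; rewrite tofrac_eq0 => /eqP.
move=> C /andP[CA Cr]; have [B sB CE] := standardP (rstd _ Cr).
rewrite CE in CA Cr *; rewrite mor_value_std //.
have [BA|] := boolP (_ \subset _); last by rewrite mulr0.
rewrite IH ?tofrac0 ?mul0r //; apply: leq_trans leA; apply: proper_card.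
by rewrite properEneq BA andbT; apply: contraNneq CA => /setC_inj ->.
Qed.

End Cobordisms.

Theorem proposition4p4 (n m : nat) (hnm : (1 <= n + m)%N) (s : boundary n m) :
  free_basis (M := polymod (special_handle s)) (standard s) (@mor_of n m).
Proof.
split=> [v|r c]; first exact: standard_generate.
exact: standard_free.
Qed.
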